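(* Let $\mathcal{H}=\mathbb{C}^2$, let $\mathcal{A}'$ be an arbitrary finite collection of observables on $\mathbb{C}^2$, and let $p'\ge 2$. Then $$d_{\mathcal{A}',p'}(\rho,\omega)\le d_{\mathcal{A}',p'}(\rho,\tau)+d_{\mathcal{A}',p'}(\tau,\omega)$$ for every $\rho,\tau,\omega\in\mathcal{S}(\mathbb{C}^2)$.
   Context: For a Hilbert space $\mathcal{H}$, $\mathcal{S}(\mathcal{H})$ is the set of positive trace-class operators with unit trace (states); observables are self-adjoint operators. For an operator $A$ on $\mathcal{H}$, $A^T$ is the operator on the dual $\mathcal{H}^*$ given by $(A^T\eta)(\varphi)=\eta(A\varphi)$. Couplings: $\mathcal{C}(\rho,\omega)=\{\Pi\in\mathcal{S}(\mathcal{H}\otimes\mathcal{H}^* ): \mathrm{tr}_{\mathcal{H}^*}[\Pi]=\omega,\ \mathrm{tr}_{\mathcal{H}}[\Pi]=\rho^T\}$. For a finite collection $\mathcal{A}=\{A_1,\dots,A_K\}$ of observables and $0<p<\infty$, the cost operator is $C_{\mathcal{A},p}=\sum_{k=1}^K|A_k\otimes I^T-I\otimes A_k^T|^p$ on $\mathcal{H}\otimes\mathcal{H}^*$, the $p$-Wasserstein distance is $D_{\mathcal{A},p}(\rho,\omega)=\big(\inf_{\Pi\in\mathcal{C}(\rho,\omega)}\mathrm{tr}[\Pi C_{\mathcal{A},p}]\big)^{\min\{1/p,1\}}$, and the $p$-Wasserstein divergence is $$d_{\mathcal{A},p}(\rho,\omega)=\Big(D_{\mathcal{A},p}^{\max\{p,1\}}(\rho,\omega)-\tfrac12\big(D_{\mathcal{A},p}^{\max\{p,1\}}(\rho,\rho)+D_{\mathcal{A},p}^{\max\{p,1\}}(\omega,\omega)\big)\Big)^{\min\{1/p,1\}}.$$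 *)

(* Defs.v *)
From HB Require Import structures.
From mathcomp Require Import all_boot all_order all_algebra.
From mathcomp Require Import sesquilinear spectral.
From mathcomp Require Import complex mxtens.
From mathcomp Require Import all_classical all_reals all_analysis.

Set Implicit Arguments.
Unset Strict Implicit.
Unset Printing Implicit Defensive.

Import Order.TTheory GRing.Theory Num.Theory.
Local Open Scope ring_scope.
Local Open Scope classical_set_scope.

Section QWass.
Variable R : realType.
Local Notation C := R[i].

Definition selfadj n (M : 'M[C]_n) : Prop := M \is hermsymmx.

(* positive operator: <v, M v> >= 0 for every vector v (this implies
   self-adjointness over C; we also require it explicitly) *)
Definition posmx n (M : 'M[C]_n) : Prop :=
  selfadj M /\ forall v : 'cV[C]_n, 0 <= ((map_mx Num.conj v)^T *m M *m v) 0 0.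

Definition is_state n (M : 'M[C]_n) : Prop := posmx M /\ \tr M = 1.

(* H (x) H^* is C^n (x) C^n, with H^* identified with C^n via the dual basis;
   in this basis the operator A^T on H^* is the transposed matrix A^T.
   Tensor products of matrices are Kronecker products (mxtens.tensmx). *)

Definition ptrace2 n (P : 'M[C]_(n * n)) : 'M[C]_n :=
  \matrix_(i, k) \sum_(j < n) P (mxtens_index (i, j)) (mxtens_index (k, j)).

Definition ptrace1 n (P : 'M[C]_(n * n)) : 'M[C]_n :=
  \matrix_(j, l) \sum_(i < n) P (mxtens_index (i, j)) (mxtens_index (i, l)).

Definition couplings n (rho omega : 'M[C]_n) : set 'M[C]_(n * n) :=
  [set P | is_state P /\ ptrace2 P = omega /\ ptrace1 P = rho^T].

(* |X|^p for a self-adjoint X, by functional calculus via the spectral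
   decomposition X = U^-1 diag(lambda) U (U unitary) *)
Definition abspow n (p : R) (X : 'M[C]_n) : 'M[C]_n :=
  let U := spectralmx X in
  invmx U *m diag_mx (\row_i ((powR (Normc.normc (spectral_diag X 0 i)) p)%:C)%C)
    *m U.

Definition cost n (A : seq 'M[C]_n) (p : R) : 'M[C]_(n * n) :=
  \sum_(a <- A) abspow p (a *t 1%:M - 1%:M *t a^T).

(* tr[Pi C] (a real number for Pi, C >= 0; we take its real part) *)
Definition transport_cost n (A : seq 'M[C]_n) (p : R) (P : 'M[C]_(n * n)) : R :=
  complex.Re (\tr (P *m cost A p)).

Definition wdist n (A : seq 'M[C]_n) (p : R) (rho omega : 'M[C]_n) : R :=
  powR (inf [set transport_cost A p P | P in couplings rho omega])
       (Num.min (p^-1) 1).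

Definition wdiv n (A : seq 'M[C]_n) (p : R) (rho omega : 'M[C]_n) : R :=
  let e := Num.max p 1 in
  powR (powR (wdist A p rho omega) e
        - 2^-1 * (powR (wdist A p rho rho) e + powR (wdist A p omega omega) e))
       (Num.min (p^-1) 1).

End QWass.

(* Main.v *)
Require Import Defs.
From HB Require Import structures.
From mathcomp Require Import all_boot all_order all_algebra.
From mathcomp Require Import sesquilinear spectral.
From mathcomp Require Import complex mxtens.
From mathcomp Require Import all_classical all_reals all_analysis.
From mathcomp Require Import ring.

(* On C^2 the operator X = a (x) I - I (x) a^T satisfies X^3 = g X, so that
   |X|^p = g^((p-2)/2) X^2: the cost of order p is a weighted quadratic one, and
   d_p is the power 2/p of a quadratic divergence.

   Write a coupling of rho and omega as a Kraus family V with
   sum V V^* = omega and sum V^* V = rho. Normalised by fourth roots, its Kraus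
   map T is a Hilbert-Schmidt contraction: an eigenvector of T^* T is also
   controlled in a twisted norm that T and T^* decrease, so every eigenvalue is
   at most 1. In KMS terms,
     2 sum tr (V^* X V Y) <= <X, X>_omega + <Y, Y>_rho,
     <X, Y>_rho = tr (rho^(1/2) X rho^(1/2) Y).
   Hence the family consisting of rho^(1/2) alone is an optimal coupling of rho
   with itself, and the squared divergence is the infimum over V of the weighted
   sum of <a, a>_rho + <a, a>_omega - 2 sum tr (V^* a V a).

   Couplings V of (rho, tau) and U of (tau, omega) compose to
   U tau^(-1/2) V. If u and v are the images of a in the KMS space of tau, the
   composite contributes <u, v>_tau, and the triangle inequality is Minkowski's
   inequality for u, a, v together with the contractivity
   <u, u>_tau <= <a, a>_rho and <v, v>_tau <= <a, a>_omega. *)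

Set Implicit Arguments.
Unset Strict Implicit.
Unset Printing Implicit Defensive.

Import Order.TTheory GRing.Theory Num.Theory.
Local Open Scope ring_scope.

(** * Adjoint and Hilbert-Schmidt norm *)

Definition adj (C : numClosedFieldType) m n (M : 'M[C]_(m, n)) : 'M[C]_(n, m) :=
  map_mx Num.conj M^T.

Section Adjoint.
Variable C : numClosedFieldType.
Implicit Types m n p : nat.

Lemma adjE m n (M : 'M[C]_(m, n)) i j : adj M i j = (M j i)^*.
Proof. by rewrite !mxE. Qed.

Lemma adjK m n (M : 'M[C]_(m, n)) : adj (adj M) = M.
Proof. by apply/matrixP=> i j; rewrite !adjE conjCK. Qed.

Lemma adjM m n p (M : 'M[C]_(m, n)) (N : 'M[C]_(n, p)) :
  adj (M *m N) = adj N *m adj M.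
Proof. by rewrite /adj trmx_mul map_mxM. Qed.

Lemma adjD m n (M N : 'M[C]_(m, n)) : adj (M + N) = adj M + adj N.
Proof. by rewrite /adj linearD map_mxD. Qed.

Lemma adjB m n (M N : 'M[C]_(m, n)) : adj (M - N) = adj M - adj N.
Proof. by rewrite /adj linearB map_mxB. Qed.

Lemma adjZ m n c (M : 'M[C]_(m, n)) : adj (c *: M) = c^* *: adj M.
Proof. by rewrite /adj linearZ map_mxZ. Qed.

Lemma adj_sum m n (I : finType) (F : I -> 'M[C]_(m, n)) :
  adj (\sum_i F i) = \sum_i adj (F i).
Proof. by rewrite /adj linear_sum map_mx_sum. Qed.

Lemma mxtrace_adj n (M : 'M[C]_n) : \tr (adj M) = (\tr M)^*.
Proof. by rewrite /mxtrace rmorph_sum; apply: eq_bigr => i _; rewrite adjE. Qed.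

Lemma hermsymE n (M : 'M[C]_n) : (M \is hermsymmx) = (adj M == M).
Proof. by rewrite qualifE /= expr0 scale1r eq_sym. Qed.

Definition hsnorm m n (M : 'M[C]_(m, n)) := \tr (M *m adj M).

Lemma hsnormE m n (M : 'M[C]_(m, n)) :
  hsnorm M = \sum_i \sum_j `|M i j| ^+ 2.
Proof.
rewrite /hsnorm /mxtrace; apply: eq_bigr => i _; rewrite mxE.
by apply: eq_bigr => j _; rewrite adjE normCK.
Qed.

Lemma hsnorm_ge0 m n (M : 'M[C]_(m, n)) : 0 <= hsnorm M.
Proof.
by rewrite hsnormE; apply: sumr_ge0 => i _; apply: sumr_ge0 => j _;
  rewrite exprn_ge0.
Qed.

Lemma hsnorm_eq0 m n (M : 'M[C]_(m, n)) : hsnorm M = 0 -> M = 0.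
Proof.
rewrite hsnormE => /eqP.
rewrite psumr_eq0; last by move=> i _; apply: sumr_ge0 => j _; rewrite exprn_ge0.
move=> /allP h; apply/matrixP => i j; have := h i (mem_index_enum _).
rewrite psumr_eq0 => [/allP/(_ j (mem_index_enum _))|k _]; last by rewrite exprn_ge0.
by rewrite expf_eq0 /= normr_eq0 => /eqP ->; rewrite mxE.
Qed.

Lemma hsnormB m n (M N : 'M[C]_(m, n)) :
  hsnorm (M - N) = hsnorm M - \tr (M *m adj N) - (\tr (M *m adj N))^* + hsnorm N.
Proof.
rewrite /hsnorm adjB mulmxBl !mulmxBr !raddfB /= -mxtrace_adj adjM adjK.
by ring.
Qed.

Lemma sum_mul_adj_eq0 m n (I : finType) (F : I -> 'M[C]_(m, n)) :
  \sum_i F i *m adj (F i) = 0 -> forall i, F i = 0.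
Proof.
move=> /(congr1 mxtrace); rewrite raddf_sum /= mxtrace0 => /eqP.
rewrite psumr_eq0 => [/allP h i|i _]; last exact: hsnorm_ge0.
by apply: hsnorm_eq0; apply/eqP; apply: h (mem_index_enum _).
Qed.

(** Vectorisation is unitary for the Hilbert-Schmidt product, so a linear map on matrices can be
    diagonalised as an ordinary matrix. *)
Lemma mxvec_dot m n (X Y : 'M[C]_(m, n)) :
  \tr (mxvec X *m adj (mxvec Y)) = \tr (X *m adj Y).
Proof.
rewrite /mxtrace big_ord1 mxE.
under [RHS]eq_bigr => i _ do rewrite mxE.
rewrite pair_bigA (reindex _ (curry_mxvec_bij _ _)) /=.
by apply: eq_bigr => -[i j] _; rewrite !adjE !mxvecE.
Qed.

Lemma diag_mx_real n (d : 'rV[C]_n) :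
  (forall i, 0 <= d 0 i) -> adj (diag_mx d) = diag_mx d.
Proof.
move=> d0; apply/matrixP => i j; rewrite adjE !mxE.
rewrite (eq_sym j i); case: eqP => [->|_]; rewrite ?mulr1n ?mulr0n ?conjC0 //.
by apply/CrealP; rewrite ger0_real.
Qed.

Lemma herm_spectral n (M : 'M[C]_n) : adj M = M ->
  exists U : 'M[C]_n, exists d : 'rV[C]_n,
  [/\ adj U *m U = 1%:M, U *m adj U = 1%:M & M = adj U *m diag_mx d *m U].
Proof.
move=> hM; exists (spectralmx M), (spectral_diag M).
have /unitarymxP U1 := spectral_unitarymx M.
have eU : invmx (spectralmx M) = adj (spectralmx M).
  exact: invmx_unitary (spectral_unitarymx M).
split; [|exact: U1|].
  by rewrite -eU mulVmx // spectral_unit.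
rewrite -eU; apply/orthomx_spectralP/hermitian_normalmx.
by rewrite hermsymE hM.
Qed.

(** In an orthonormal eigenbasis of [S] the left side is a sum of squared coordinates of [X]
    weighted by the eigenvalues. *)
Lemma herm_contraction n (S : {linear 'M[C]_n -> 'M[C]_n}) :
  (forall X Y, \tr (S X *m adj Y) = \tr (X *m adj (S Y))) ->
  (forall c X, X != 0 -> S X = c *: X -> c <= 1) ->
  forall X, \tr (S X *m adj X) <= hsnorm X.
Proof.
move=> Sh Sc X; pose M := lin_mx S.
have MX Y : mxvec Y *m M = mxvec (S Y) by rewrite mul_vec_lin.
have hM : adj M = M.
  apply/matrixP => i j; rewrite adjE.
  have e Y Z : \tr (mxvec Y *m M *m adj (mxvec Z)) =
               \tr (mxvec Y *m adj (mxvec Z *m M)).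
    by rewrite !MX !mxvec_dot Sh.
  have := e (vec_mx (delta_mx 0 i)) (vec_mx (delta_mx 0 j)).
  have -> : adj (mxvec (vec_mx (delta_mx 0 j))) = delta_mx j 0 :> 'cV[C]_(n * n).
    by rewrite vec_mxK /adj trmx_delta map_delta_mx.
  by rewrite !vec_mxK -!rowE -colE !trace_mx11 !mxE => ->.
have [U [d [U1 U2 eM]]] := herm_spectral hM.
have dle i : d 0 i <= 1.
  (* [M] acts on row vectors, so the rows of [U], reshaped into matrices, are eigenvectors of
     [S]. *)
  have UM : U *m M = diag_mx d *m U by rewrite eM !mulmxA U2 mul1mx.
  have nz : row i U != 0.
    apply/eqP => h; have /matrixP/(_ i i) := U2; rewrite !mxE eqxx.
    under eq_bigr => k _.
      have -> : U i k = 0 by move/rowP/(_ k): h; rewrite !mxE.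
      rewrite mul0r; over.
    by rewrite big1 // => /esym/eqP; rewrite oner_eq0.
  apply: (Sc _ (vec_mx (row i U))).
    by apply: contra nz => /eqP /(congr1 mxvec); rewrite vec_mxK linear0 => ->.
  apply: (can_inj mxvecK); rewrite -MX linearZ /= vec_mxK -row_mul UM.
  by apply/rowP => k; rewrite mxE mul_diag_mx !mxE.
rewrite -mxvec_dot -MX eM; pose v := mxvec X *m adj U.
have -> : \tr (mxvec X *m (adj U *m diag_mx d *m U) *m adj (mxvec X)) =
   \tr (v *m diag_mx d *m adj v) by rewrite adjM adjK !mulmxA.
have -> : hsnorm X = hsnorm v.
  by rewrite /hsnorm -mxvec_dot adjM adjK -mulmxA [adj U *m _]mulmxA U1 mul1mx.
rewrite hsnormE big_ord1 trace_mx11 mxE; apply: ler_sum => k _.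
rewrite mul_mx_diag mxE adjE mulrAC -normCK.
by rewrite ler_piMr // exprn_ge0.
Qed.

End Adjoint.

(** * Hermitian pseudo-inverses and Kraus maps *)

Section PseudoInverse.
Variables (C : numClosedFieldType) (n : nat).
Implicit Types s t X Y : 'M[C]_n.

(** The Moore-Penrose inverse of a Hermitian matrix. States may be singular; [s *m s'] is the
    projection onto the support of [s]. *)
Definition herm_pinv s s' : Prop :=
  [/\ adj s = s, adj s' = s', s *m s' = s' *m s,
      s *m s' *m s = s & s' *m s *m s' = s'].

(** A fourth root is taken because [X] goes to [s *m X *m s] turns the KMS norm into the
    Hilbert-Schmidt norm. *)
Lemma psd_fourth_root (M : 'M[C]_n) : adj M = M ->
  (forall v : 'cV[C]_n, 0 <= (adj v *m M *m v) 0 0) ->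
  exists s, exists s', herm_pinv s s' /\ s *m s *m (s *m s) = M.
Proof.
move=> hM pM; have [U [d [U1 U2 eM]]] := herm_spectral hM.
have d0 i : 0 <= d 0 i.
  have := pM (adj (row i U)); rewrite adjK eM.
  suff -> : row i U *m (adj U *m diag_mx d *m U) *m adj (row i U) =
            (d 0 i)%:M by rewrite mxE eqxx mulr1n.
  have e1 : row i U *m adj U = delta_mx 0 i by rewrite -row_mul U2 row1.
  have e2 : U *m adj (row i U) = delta_mx i 0.
    by rewrite -[LHS]adjK adjM adjK e1 /adj trmx_delta map_delta_mx.
  rewrite !mulmxA e1 -mulmxA e2 -rowE; apply/matrixP => a b.
  by rewrite !ord1 -colE !mxE !eqxx.
pose D (f : C -> C) := adj U *m diag_mx (map_mx f d) *m U.
have DM f g : D f *m D g = D (fun x => f x * g x).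
  rewrite /D !mulmxA -[_ *m U *m adj U]mulmxA U2 mulmx1 -[adj U *m _ *m _]mulmxA.
  rewrite mulmx_diag; congr (_ *m diag_mx _ *m _).
  by apply/rowP => i; rewrite !mxE.
have Deq f g : (forall x, 0 <= x -> f x = g x) -> D f = D g.
  by move=> fg; congr (_ *m diag_mx _ *m _); apply/rowP => i; rewrite !mxE fg.
have Dadj f : (forall x, 0 <= x -> 0 <= f x) -> adj (D f) = D f.
  move=> f0; rewrite !adjM adjK diag_mx_real ?mulmxA // => i.
  by rewrite mxE f0.
(* The convention [0^-1 = 0] makes [D g] the pseudo-inverse of [D f] even when [M] has a kernel. *)
pose f x : C := sqrtC (sqrtC x); pose g x := (f x)^-1.
have f0 x : 0 <= x -> 0 <= f x by move=> x0; rewrite !sqrtC_ge0.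
have fgf x : f x * g x * f x = f x.
  by have [->|h] := eqVneq (f x) 0; rewrite ?mulr0 // mulfVK.
have gfg x : g x * f x * g x = g x.
  by rewrite /g; have [->|h] := eqVneq (f x) 0; rewrite ?invr0 ?mulr0 // mulVf // mul1r.
exists (D f), (D g); split; last first.
  rewrite !DM eM; congr (_ *m diag_mx _ *m _); apply/rowP => i.
  by rewrite !mxE -!expr2 !sqrtCK.
split; rewrite ?DM; try exact: Dadj; try by apply: Deq => x _; rewrite // mulrC.
by apply: Dadj => x x0; rewrite invr_ge0 f0.
Qed.

Lemma pinv_sqr s s' : herm_pinv s s' -> herm_pinv (s *m s) (s' *m s').
Proof.
case=> h1 h2 h3 h4 h5; split; rewrite ?adjM ?h1 ?h2 //.
- by apply: comm_mxM; apply: comm_mx_sym; apply: comm_mxM; apply: comm_mx_sym.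
- have e1 : s *m (s *m s') = s by rewrite h3 mulmxA.
  have e2 : s' *m s *m s = s by rewrite -h3.
  by rewrite -[in RHS](congr2 mulmx e1 e2) !mulmxA.
- have e1 : s' *m (s' *m s) = s' by rewrite -h3 mulmxA.
  have e2 : s *m s' *m s' = s' by rewrite h3.
  by rewrite -[in RHS](congr2 mulmx e1 e2) !mulmxA.
Qed.

(** With [q = s *m s' - 1%:M], the sum of the [q V_i V_i^* q^*] vanishes because [q] kills [s];
    hence every [q V_i] is zero. *)
Lemma pinv_support (I : finType) (V : I -> 'M[C]_n) s s' :
  herm_pinv s s' -> \sum_i V i *m adj (V i) = s *m s *m (s *m s) ->
  forall i, s *m s' *m V i = V i.
Proof.
move=> [h1 h2 h3 h4 h5] hV i; apply/eqP; rewrite -subr_eq0; apply/eqP.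
move: i; apply: sum_mul_adj_eq0.
pose q := s *m s' - 1%:M.
have qs : q *m s = 0 by rewrite mulmxBl mul1mx h4 subrr.
under eq_bigr => i _.
  have -> : s *m s' *m V i - V i = q *m V i by rewrite mulmxBl mul1mx.
  rewrite adjM mulmxA -[q *m V i *m _]mulmxA; over.
by rewrite -mulmx_suml -mulmx_sumr hV !mulmxA qs !mul0mx.
Qed.

End PseudoInverse.

Section Kraus.
Variables (C : numClosedFieldType) (n : nat) (I : finType).
Implicit Types (V W : I -> 'M[C]_n) (X Y s t : 'M[C]_n).

(** The Heisenberg convention: the dual map for the trace pairing comes from the family of
    adjoints. *)
Definition kraus V X := \sum_i adj (V i) *m X *m V i.

Fact kraus_is_linear V : linear (kraus V).
Proof.
move=> c X Y; rewrite /kraus scaler_sumr -big_split /=.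
by apply: eq_bigr => i _; rewrite mulmxDr mulmxDl -scalemxAr -scalemxAl.
Qed.

HB.instance Definition _ V := GRing.isLinear.Build C 'M[C]_n 'M[C]_n *:%R
  (kraus V) (kraus_is_linear V).

Lemma kraus_adjoint V X Y :
  \tr (kraus V X *m Y) = \tr (X *m kraus (fun i => adj (V i)) Y).
Proof.
rewrite mulmx_suml mulmx_sumr !raddf_sum /=; apply: eq_bigr => i _.
by rewrite adjK -!mulmxA mxtrace_mulC -!mulmxA.
Qed.

Lemma adj_kraus V X : adj (kraus V X) = kraus V (adj X).
Proof.
by rewrite adj_sum; apply: eq_bigr => i _; rewrite !adjM adjK mulmxA.
Qed.

(* A noncommutative Schur test, with the weights [s *m s] and [t *m t] that the
   two Kraus maps exchange. *)
Lemma kraus_weighted_contraction W s s' t t' X :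
  herm_pinv s s' -> herm_pinv t t' ->
  (forall i, s *m s' *m W i = W i) ->
  kraus (fun i => adj (W i)) (t *m t) = s *m s -> kraus W (s *m s) = t *m t ->
  hsnorm (t' *m kraus W X *m t) <= hsnorm (s' *m X *m s).
Proof.
move=> [s1 s2 s3 s4 s5] [t1 t2 t3 t4 t5] Ws W1 W2.
set G := t' *m _ *m t.
have WsE i : adj (W i) *m s *m s' = adj (W i).
  by rewrite -[in RHS]Ws !adjM s1 s2 -mulmxA s3.
have tG : t *m t' *m G = G by rewrite /G !mulmxA t3 t5.
have GE : G = t' *m kraus W X *m t by [].
(* The claim is that the sum of the [hsnorm (A i - B i)] is nonnegative: the [A] part gives the
   right-hand side, while the [B] part and the cross term both give [hsnorm G]. *)
clearbody G; pose A i := s' *m X *m W i *m t; pose B i := s *m W i *m t' *m G.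
have : 0 <= \sum_i hsnorm (A i - B i) by apply: sumr_ge0 => i _; apply: hsnorm_ge0.
under eq_bigr => i _ do rewrite hsnormB.
rewrite big_split /= !sumrB.
have -> : \sum_i hsnorm (A i) = hsnorm (s' *m X *m s).
  rewrite /hsnorm -raddf_sum /=.
  under eq_bigr => i _.
    have -> : A i *m adj (A i) =
       s' *m X *m (W i *m (t *m t) *m adj (W i)) *m adj (s' *m X).
      by rewrite /A !adjM t1 !mulmxA.
    over.
  rewrite -mulmx_suml -mulmx_sumr.
  have <- : kraus (fun i => adj (W i)) (t *m t) =
      \sum_i W i *m (t *m t) *m adj (W i).
    by apply: eq_bigr => i _; rewrite adjK.
  by rewrite W1 [adj (s' *m X *m s)]adjM s1 !mulmxA.
have -> : \sum_i hsnorm (B i) = hsnorm G.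
  under eq_bigr => i _.
    have -> : hsnorm (B i) =
       \tr (adj (W i) *m (s *m s) *m W i *m (t' *m G *m adj G *m t')).
      rewrite /hsnorm /B !adjM t2 s1 !mulmxA mxtrace_mulC !mulmxA.
      by rewrite mxtrace_mulC !mulmxA mxtrace_mulC !mulmxA.
    over.
  rewrite -raddf_sum -mulmx_suml /= -[\sum_i _]/(kraus W (s *m s)) W2.
  by rewrite !mulmxA mxtrace_mulC !mulmxA -t3 t4 tG.
have AB : \sum_i \tr (A i *m adj (B i)) = hsnorm G.
  under eq_bigr => i _.
    have -> : \tr (A i *m adj (B i)) =
       \tr (adj (W i) *m X *m W i *m (t *m adj G *m t')).
      rewrite /A /B !adjM t2 s1 !mulmxA mxtrace_mulC !mulmxA mxtrace_mulC.
      by rewrite !mulmxA WsE.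
    over.
  rewrite -raddf_sum -mulmx_suml /= -[\sum_i _]/(kraus W X).
  transitivity (\tr (t' *m kraus W X *m t *m adj G)); last by rewrite -GE.
  by rewrite !mulmxA mxtrace_mulC !mulmxA.
rewrite -(rmorph_sum Num.conj) /= AB (CrealP _) ?ger0_real ?hsnorm_ge0 //.
by rewrite addrNK subr_ge0.
Qed.

End Kraus.

(** * KMS contractivity *)

Section Contraction.
Variables (C : numClosedFieldType) (n : nat) (I : finType).
Implicit Types (V W : I -> 'M[C]_n) (X Y s t : 'M[C]_n).

Lemma kraus_contraction W s s' t t' X :
  herm_pinv s s' -> herm_pinv t t' ->
  (forall i, s *m s' *m W i = W i) -> (forall i, t *m t' *m adj (W i) = adj (W i)) ->
  kraus (fun i => adj (W i)) (t *m t) = s *m s -> kraus W (s *m s) = t *m t ->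
  hsnorm (kraus W X) <= hsnorm X.
Proof.
move=> hs ht Ws Wt W1 W2.
pose S := kraus (fun i => adj (W i)) \o kraus W.
have SE Y Z : \tr (S Y *m adj Z) = \tr (kraus W Y *m adj (kraus W Z)).
  rewrite [LHS]kraus_adjoint adj_kraus /kraus; congr (\tr (_ *m _)).
  by apply: eq_bigr => i _; rewrite !adjK.
rewrite [leLHS]/hsnorm -SE; move: X.
apply: (@herm_contraction C n S) => [Y Z|c X X0 SX].
  by rewrite SE -[in RHS](adjK Y) -adjM mxtrace_adj mxtrace_mulC SE -mxtrace_adj
    adjM adjK mxtrace_mulC.
(* [c] is an eigenvalue of T^* T, and both T and T^* decrease the twisted norm. *)
have h1 := kraus_weighted_contraction X hs ht Ws W1 W2.
have := kraus_weighted_contraction (kraus W X) ht hs Wt.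
have -> : kraus (fun i => adj (adj (W i))) (s *m s) = t *m t.
  by rewrite -W2 /kraus; apply: eq_bigr => i _; rewrite !adjK.
move=> /(_ erefl W1) h2; have := le_trans h2 h1.
have SX' : kraus (fun i => adj (W i)) (kraus W X) = c *: X := SX.
rewrite SX' -scalemxAr -scalemxAl.
set G := s' *m X *m s.
have -> : hsnorm (c *: G) = `|c| ^+ 2 * hsnorm G.
  by rewrite /hsnorm adjZ -scalemxAr -scalemxAl !mxtraceZ mulrA normCK [c * _]mulrC.
(* A vanishing twisted norm gives no bound on [c], but then [kraus W X = 0], which forces
   [c = 0]. *)
have [G0|G0] := eqVneq G 0.
  have W0 : kraus W X = 0.
    case: hs => s1 s2 s3 s4 s5; rewrite /kraus big1 // => i _.
    transitivity (adj (W i) *m s *m G *m s' *m W i).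
      rewrite -[in LHS](Ws i) !adjM s1 s2 !mulmxA.
      by rewrite -[adj (W i) *m s' *m s]mulmxA -s3 !mulmxA.
    by rewrite G0 mulmx0 !mul0mx.
  move/eqP: SX'; rewrite W0 linear0 eq_sym scaler_eq0 (negPf X0) orbF => /eqP ->.
  by rewrite ler01.
have Gp : 0 < hsnorm G.
  rewrite lt_neqAle hsnorm_ge0 andbT eq_sym.
  by apply: contra G0 => /eqP /hsnorm_eq0 ->.
rewrite ger_pMl // expr_le1 // => c1.
have c0 : 0 <= c.
  have Xp : 0 < hsnorm X.
    rewrite lt_neqAle hsnorm_ge0 andbT eq_sym.
    by apply: contra X0 => /eqP /hsnorm_eq0 ->.
  rewrite -(pmulr_lge0 _ Xp).
  have e : \tr (kraus (fun i => adj (W i)) (kraus W X) *m adj X) =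
           hsnorm (kraus W X) := SE X X.
  by move: e; rewrite SX' -scalemxAl mxtraceZ -/(hsnorm X) => ->; apply: hsnorm_ge0.
by rewrite -(ger0_norm c0).
Qed.

(** After normalisation the trace pairs [K], the image of [s *m X *m s], with [Z = t *m Y *m t]. It
    is bounded by expanding [hsnorm (K - Z)] and using that the normalised map is a contraction. *)
Lemma kraus_bound V s s' t t' X Y :
  herm_pinv s s' -> herm_pinv t t' ->
  \sum_i V i *m adj (V i) = s *m s *m (s *m s) ->
  \sum_i adj (V i) *m V i = t *m t *m (t *m t) ->
  adj X = X -> adj Y = Y ->
  2 * \tr (kraus V X *m Y) <=
  \tr (s *m s *m X *m (s *m s) *m X) + \tr (t *m t *m Y *m (t *m t) *m Y).
Proof.
move=> hs ht V1 V2 hX hY.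
have Vs := pinv_support hs V1.
have Vt : forall i, t *m t' *m adj (V i) = adj (V i).
  apply: (pinv_support ht); rewrite -V2.
  by apply: eq_bigr => i _; rewrite !adjK.
have := hs; case=> s1 s2 s3 s4 s5; have := ht; case=> t1 t2 t3 t4 t5.
have Vt' i : V i *m t' *m t = V i.
  by rewrite -[RHS]adjK -Vt !adjM adjK t1 t2 mulmxA.
have Vs' i : adj (V i) *m s' *m s = adj (V i).
  by rewrite -[in RHS]Vs !adjM s1 s2 mulmxA.
(* This scaling makes the two Kraus maps exchange [s^2] and [t^2]: the sum of the [W_i t^2 W_i^*] is
   [s' s^4 s' = s^2], and symmetrically. *)
pose W i := s' *m V i *m t'.
have WV i : s *m W i *m t = V i by rewrite /W !mulmxA Vs Vt'.
have contr := @kraus_contraction W s s' t t' (s *m X *m s) hs ht.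
have {}contr : hsnorm (kraus W (s *m X *m s)) <= hsnorm (s *m X *m s).
  apply: contr.
  - by move=> i; rewrite /W !mulmxA s3 s5.
  - by move=> i; rewrite /W !adjM t2 !mulmxA t3 t5.
  - transitivity (s' *m (\sum_i V i *m adj (V i)) *m s').
      rewrite mulmx_sumr mulmx_suml; apply: eq_bigr => i _.
      rewrite adjK /W !adjM s2 t2.
      transitivity (s' *m (V i *m t' *m t) *m (t *m t' *m adj (V i)) *m s').
        by rewrite !mulmxA.
      by rewrite Vt' Vt !mulmxA.
    have sl : s' *m s *m s = s by rewrite -s3.
    have sr : s *m (s *m s') = s by rewrite s3 mulmxA.
    rewrite V1; transitivity ((s' *m s *m s) *m (s *m (s *m s'))).
      by rewrite !mulmxA.
    by rewrite sl sr.
  - transitivity (t' *m (\sum_i adj (V i) *m V i) *m t').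
      rewrite mulmx_sumr mulmx_suml; apply: eq_bigr => i _.
      rewrite /W !adjM s2 t2.
      transitivity (t' *m (adj (V i) *m s' *m s) *m (s *m s' *m V i) *m t').
        by rewrite !mulmxA.
      by rewrite Vs' Vs !mulmxA.
    have tl : t' *m t *m t = t by rewrite -t3.
    have tr : t *m (t *m t') = t by rewrite t3 mulmxA.
    rewrite V2; transitivity ((t' *m t *m t) *m (t *m (t *m t'))).
      by rewrite !mulmxA.
    by rewrite tl tr.
have -> : \tr (kraus V X *m Y) = \tr (kraus W (s *m X *m s) *m (t *m Y *m t)).
  have -> : kraus V X = t *m kraus W (s *m X *m s) *m t.
    rewrite /kraus mulmx_sumr mulmx_suml; apply: eq_bigr => i _.
    by rewrite -{1 2}WV !adjM s1 t1 !mulmxA.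
  by rewrite -!mulmxA mxtrace_mulC -!mulmxA.
set K := kraus W _ in contr *; set Z := t *m Y *m t.
have hK : adj K = K by rewrite adj_kraus !adjM s1 hX !mulmxA.
have hZ : adj Z = Z by rewrite !adjM t1 hY !mulmxA.
have := hsnorm_ge0 (K - Z); rewrite hsnormB -mxtrace_adj adjM !adjK hZ hK.
rewrite [\tr (Z *m K)]mxtrace_mulC => h.
have -> : \tr (s *m s *m X *m (s *m s) *m X) = hsnorm (s *m X *m s).
  by rewrite /hsnorm !adjM s1 hX !mulmxA mxtrace_mulC !mulmxA mxtrace_mulC !mulmxA.
have -> : \tr (t *m t *m Y *m (t *m t) *m Y) = hsnorm Z.
  by rewrite /hsnorm hZ /Z !mulmxA mxtrace_mulC !mulmxA mxtrace_mulC !mulmxA.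
rewrite -subr_ge0.
have -> : hsnorm (s *m X *m s) + hsnorm Z - 2 * \tr (K *m Z) =
  (hsnorm (s *m X *m s) - hsnorm K) +
  (hsnorm K - \tr (K *m Z) - \tr (K *m Z) + hsnorm Z) by ring.
by rewrite addr_ge0 // subr_ge0.
Qed.

End Contraction.

(** * Composition of couplings *)

Section Gluing.
Variables (C : numClosedFieldType) (n : nat).
Implicit Types (X Y s t r : 'M[C]_n).

Definition kraus_coupling (I : finType) (V : I -> 'M[C]_n) (rho omega : 'M[C]_n) :=
  \sum_i V i *m adj (V i) = omega /\ \sum_i adj (V i) *m V i = rho.

(* KMS inner product of hermitian [X] and [Y] when [r] is the square root of a state. *)
Definition kms r X Y := \tr (r *m X *m r *m Y).

Lemma kmsC r X Y : kms r X Y = kms r Y X.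
Proof. by rewrite /kms -mulmxA mxtrace_mulC !mulmxA. Qed.

Lemma kmsDl r X Y Z : kms r (X + Y) Z = kms r X Z + kms r Y Z.
Proof. by rewrite /kms mulmxDr !mulmxDl mxtraceD. Qed.

Lemma kmsZl r c X Z : kms r (c *: X) Z = c * kms r X Z.
Proof. by rewrite /kms -scalemxAr -!scalemxAl mxtraceZ. Qed.

Lemma kms_ge0 s X : adj s = s -> adj X = X -> 0 <= kms (s *m s) X X.
Proof.
move=> hs hX; have := hsnorm_ge0 (s *m X *m s).
by rewrite /hsnorm /kms !adjM hs hX !mulmxA mxtrace_mulC !mulmxA mxtrace_mulC !mulmxA.
Qed.

(* The difference is half of the squared norm of the commutator of [s *m s] and [X]. *)
Lemma kms_le s X : adj s = s -> adj X = X ->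
  kms (s *m s) X X <= \tr (s *m s *m (s *m s) *m (X *m X)).
Proof.
move=> hs hX; have hr : adj (s *m s) = s *m s by rewrite adjM hs.
rewrite /kms; move: (s *m s) hr => r hr; rewrite -subr_ge0.
have := hsnorm_ge0 (r *m X - X *m r).
rewrite hsnormB -mxtrace_adj [adj (_ *m adj _)]adjM adjK /hsnorm !adjM hr hX.
have -> : \tr (r *m X *m (X *m r)) = \tr (r *m r *m (X *m X)).
  by rewrite mulmxA mxtrace_mulC !mulmxA.
have -> : \tr (X *m r *m (r *m X)) = \tr (r *m r *m (X *m X)).
  by rewrite !mulmxA mxtrace_mulC [RHS]mxtrace_mulC !mulmxA [RHS]mxtrace_mulC !mulmxA.
have -> : \tr (r *m X *m (r *m X)) = \tr (r *m X *m r *m X) by rewrite !mulmxA.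
have -> : \tr (X *m r *m (X *m r)) = \tr (r *m X *m r *m X).
  by rewrite !mulmxA mxtrace_mulC !mulmxA.
rewrite [X in 0 <= X -> _](_ : _ = 2 * (\tr (r *m r *m (X *m X)) -
  \tr (r *m X *m r *m X))); last by ring.
by rewrite pmulr_rge0 // ltr0n.
Qed.

Lemma adj_kms s X : adj s = s -> adj X = X -> adj (s *m X *m s) = s *m X *m s.
Proof. by move=> hs hX; rewrite !adjM hs hX mulmxA. Qed.

Variables (I J : finType) (V : I -> 'M[C]_n) (U : J -> 'M[C]_n).
Variables (a a' s s' b b' : 'M[C]_n).
Hypothesis (ha : herm_pinv a a') (hs : herm_pinv s s') (hb : herm_pinv b b').
Hypothesis (hV : kraus_coupling V (a *m a *m (a *m a)) (s *m s *m (s *m s))).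
Hypothesis (hU : kraus_coupling U (s *m s *m (s *m s)) (b *m b *m (b *m b))).

(** Here [a], [s], [b] are fourth roots of three states, and [s' *m s'] inverts the square root of
    the middle one on its support. *)
Definition glue (p : J * I) := U p.1 *m (s' *m s') *m V p.2.

Let hr := pinv_sqr hs.

(** The range of [V i] lies in the support of [s], on which [s^2 s'^2] is the identity. *)
Let VP i : s *m s *m (s' *m s') *m V i = V i.
Proof.
rewrite -[RHS](pinv_support hs hV.1) -{1}(pinv_support hs hV.1); case: hs => _ _ h3 h4 _.
by rewrite !mulmxA h3 -[s *m s *m s']mulmxA h3 !mulmxA h4 -h3 h4.
Qed.

Let UP j : U j *m (s' *m s') *m (s *m s) = U j.
Proof.
have e : s *m s' *m adj (U j) = adj (U j).
  apply: (pinv_support (V := fun j => adj (U j)) hs); rewrite -hU.2.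
  by apply: eq_bigr => k _; rewrite adjK.
have hcomm : s *m s *m (s' *m s') *m adj (U j) = adj (U j).
  rewrite -[RHS]e -{1}e; case: hs => _ _ h3 h4 _.
  by rewrite !mulmxA h3 -[s *m s *m s']mulmxA h3 !mulmxA h4 -h3 h4.
have [s1 s2 _ _ _] := hs.
by rewrite -[RHS]adjK -hcomm !adjM adjK s1 s2 !mulmxA.
Qed.

(** Summing over the inner index first produces the middle state [s^4]; [s'^2 s^4 s'^2] is its
    support projection, which the outer family absorbs. *)
Lemma glue_coupling :
  kraus_coupling glue (a *m a *m (a *m a)) (b *m b *m (b *m b)).
Proof.
have [r1 r2 r3 r4 r5] := hr.
have UP' j : s *m s *m (s' *m s') *m adj (U j) = adj (U j).
  by rewrite -[in RHS]UP !adjM; case: hs => -> -> _ _ _; rewrite !mulmxA.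
have VP' i : adj (V i) *m (s' *m s') *m (s *m s) = adj (V i).
  by rewrite -[in RHS]VP !adjM; case: hs => -> -> _ _ _; rewrite !mulmxA.
split.
  rewrite -hU.1 -(pair_bigA _ (fun j i => glue (j, i) *m adj (glue (j, i)))) /=.
  apply: eq_bigr => j _.
  transitivity (U j *m (s' *m s') *m (\sum_i V i *m adj (V i)) *m
     ((s' *m s') *m adj (U j))).
    rewrite mulmx_sumr mulmx_suml; apply: eq_bigr => i _.
    by rewrite /glue !adjM; case: hs => _ -> _ _ _; rewrite !mulmxA.
  rewrite hV.1 mulmxA [LHS](_ : _ = U j *m (s' *m s') *m (s *m s) *m
    (s *m s *m (s' *m s') *m adj (U j))); last by rewrite !mulmxA.
  by rewrite UP UP'.
rewrite -hV.2 -(pair_bigA _ (fun j i => adj (glue (j, i)) *m glue (j, i))) /=.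
rewrite exchange_big; apply: eq_bigr => i _ /=.
transitivity (adj (V i) *m (s' *m s') *m (\sum_j adj (U j) *m U j) *m
   ((s' *m s') *m V i)).
  rewrite mulmx_sumr mulmx_suml; apply: eq_bigr => j _.
  by rewrite /glue !adjM; case: hs => _ -> _ _ _; rewrite !mulmxA.
rewrite hU.2 mulmxA [LHS](_ : _ = adj (V i) *m (s' *m s') *m (s *m s) *m
  (s *m s *m (s' *m s') *m V i)); last by rewrite !mulmxA.
by rewrite VP VP'.
Qed.

(* The parameter [l] linearises Minkowski's inequality, so that infima over
   couplings can be taken before it is optimised. *)
Lemma glue_bound (A : 'M[C]_n) (l : C) : adj A = A -> 0 < l ->
  kms (a *m a) A A + kms (b *m b) A A - 2 * \tr (kraus glue A *m A) <=
  (1 + l) * (kms (a *m a) A A + kms (s *m s) A A - 2 * \tr (kraus V A *m A)) +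
  (1 + l^-1) * (kms (s *m s) A A + kms (b *m b) A A - 2 * \tr (kraus U A *m A)).
Proof.
move=> hA l0; set r := s *m s; set r' := s' *m s'.
have [r1 r2 r3 r4 r5] := hr; rewrite -/r -/r' in r1 r2 r3 r4 r5.
have UPr j : U j *m r' *m r = U j := UP j.
have VPr i : r *m r' *m V i = V i := VP i.
have bU X Y : adj X = X -> adj Y = Y ->
    2 * \tr (kraus U X *m Y) <= kms (b *m b) X X + kms r Y Y.
  exact: (kraus_bound hb hs hU.1 hU.2).
have bV X Y : adj X = X -> adj Y = Y ->
    2 * \tr (kraus V X *m Y) <= kms r X X + kms (a *m a) Y Y.
  exact: (kraus_bound hs ha hV.1 hV.2).
have [s1 _ _ _ _] := hs.
have r_ge0 X : adj X = X -> 0 <= kms r X X by exact: kms_ge0.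
have glE j i : glue (j, i) = U j *m r' *m V i by [].
clearbody r r'; pose Va i := adj (V i).
(* [u] and [v] represent the images of [A] in the KMS space of the middle state: [r *m v *m r] is
   [kraus U A], and likewise for [u]. *)
pose v := r' *m kraus U A *m r'; pose u := r' *m kraus Va A *m r'.
have hv : adj v = v by rewrite adj_kms // adj_kraus hA.
have hu : adj u = u by rewrite adj_kms // adj_kraus hA.
have rv : r *m v *m r = kraus U A.
  rewrite /v /kraus !(mulmx_sumr, mulmx_suml); apply: eq_bigr => j _.
  transitivity (r *m r' *m adj (U j) *m A *m (U j *m r' *m r)).
    by rewrite !mulmxA.
  rewrite UPr; congr (_ *m _ *m _).
  by rewrite -[in RHS]UPr !adjM r1 r2 mulmxA.
have ru : r *m u *m r = kraus Va A.
  rewrite /u /kraus !(mulmx_sumr, mulmx_suml); apply: eq_bigr => j _.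
  transitivity (r *m r' *m V j *m A *m (adj (V j) *m r' *m r)).
    by rewrite /Va adjK !mulmxA.
  rewrite /Va adjK VPr; congr (_ *m _).
  by rewrite -[in RHS]VPr !adjM r1 r2 mulmxA.
have kv X : kms r v X = \tr (kraus U A *m X) by rewrite /kms rv.
have ku X : kms r u X = \tr (kraus V X *m A).
  by rewrite /kms ru mxtrace_mulC kraus_adjoint mxtrace_mulC.
have uv : \tr (kraus glue A *m A) = kms r u v.
  rewrite ku; congr (\tr (_ *m _)).
  rewrite /kraus -(pair_bigA _ (fun j i => adj (glue (j, i)) *m A *m glue (j, i))) /=.
  rewrite exchange_big; apply: eq_bigr => i _ /=.
  rewrite /v /kraus !(mulmx_sumr, mulmx_suml); apply: eq_bigr => j _.
  by rewrite glE !adjM r2 !mulmxA.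
(* Testing the bound for [U] on [A] and on [v] itself puts [2 * kms r v v] on the left, and one copy
   cancels. *)
have vv : kms r v v <= kms (b *m b) A A.
  have := bU _ _ hA hv; rewrite -kv.
  by rewrite mulr_natl mulr2n lerD2r.
have uu : kms r u u <= kms (a *m a) A A.
  have := bV _ _ hu hA; rewrite -ku.
  by rewrite mulr_natl mulr2n lerD2l.
have lr : l^* = l by apply/CrealP; rewrite gtr0_real.
(* Completing the square: the difference of the two sides is [l^-1] times the squared norm of [w],
   plus the slack in [uu] and [vv]. *)
pose w := l *: (u - A) + (v - A).
have hw : adj w = w by rewrite /w adjD adjZ !adjB hu hv hA lr.
have w0 : 0 <= kms r w w by exact: r_ge0.
rewrite uv -ku -(kv A) -subr_ge0.
set LHS := (X in 0 <= X).
have -> : LHS = l^-1 * kms r w w + (l * (kms (a *m a) A A - kms r u u) +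
             l^-1 * (kms (b *m b) A A - kms r v v)).
  rewrite /LHS; have -> : w = l *: u + (- l) *: A + (1 *: v + (-1) *: A).
    by rewrite /w scalerBr scaleNr scale1r scaleN1r.
  do ?[rewrite !(kmsDl, kmsZl) | rewrite ![kms r _ (_ + _)]kmsC
      | rewrite ![kms r _ (_ *: _)]kmsC].
  rewrite [kms r v u]kmsC [kms r A u]kmsC [kms r A v]kmsC.
  by field; rewrite gt_eqF.
by rewrite !addr_ge0 ?mulr_ge0 ?subr_ge0 ?invr_ge0 // ltW.
Qed.

End Gluing.

(** * Kraus families, couplings and the cost operator *)

Section Choi.
Variables (C : numClosedFieldType) (n : nat).
Implicit Types (X Y V W : 'M[C]_n).

(** Operators as vectors of $H \otimes H^*$, in the index order of the Kronecker product, so that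
    tensors act by left and right multiplication. *)
Definition cvec V : 'cV[C]_(n * n) :=
  \col_p V (mxtens_unindex p).1 (mxtens_unindex p).2.

Lemma sum_mxtens (F : 'I_n -> 'I_n -> C) :
  \sum_(p < n * n) F (mxtens_unindex p).1 (mxtens_unindex p).2 =
  \sum_i \sum_j F i j.
Proof.
rewrite pair_bigA (reindex (@mxtens_index n n)); last first.
  by exists (@mxtens_unindex n n) => p _; rewrite (mxtens_indexK, mxtens_unindexK).
by apply: eq_bigr => p _; rewrite mxtens_indexK.
Qed.

Lemma tens_cvec X Y V : (X *t Y^T) *m cvec V = cvec (X *m V *m Y).
Proof.
apply/colP => p; rewrite !mxE.
under eq_bigr => q _ do rewrite !mxE.
rewrite (sum_mxtens (fun i j => X (mxtens_unindex p).1 i * Y j (mxtens_unindex p).2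
   * V i j)).
under [RHS]eq_bigr => j _ do rewrite !mxE mulr_suml.
rewrite [RHS]exchange_big; apply: eq_bigr => i _; apply: eq_bigr => j _.
by rewrite mulrAC.
Qed.

Lemma cvec_dot V W : adj (cvec V) *m cvec W = (\tr (adj V *m W))%:M.
Proof.
apply/matrixP => x y; rewrite !ord1 mxE [RHS]mxE eqxx mulr1n.
under eq_bigr => q _ do rewrite adjE !mxE.
rewrite (sum_mxtens (fun i j => (V i j)^* * W i j)) exchange_big.
by apply: eq_bigr => j _; rewrite mxE; apply: eq_bigr => i _; rewrite adjE.
Qed.

Variable I : finType.
Implicit Type K : I -> 'M[C]_n.

Definition choi K : 'M[C]_(n * n) := \sum_i cvec (K i) *m adj (cvec (K i)).

Lemma choi_tens K X Y : \tr (choi K *m (X *t Y^T)) = \tr (kraus K X *m Y).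
Proof.
rewrite !mulmx_suml !raddf_sum /=; apply: eq_bigr => i _.
rewrite -[in LHS]mulmxA [LHS]mxtrace_mulC -[in LHS]mulmxA tens_cvec cvec_dot.
by rewrite mxtrace_scalar mulr1n !mulmxA.
Qed.

Lemma choiE K i j k l : choi K (mxtens_index (i, j)) (mxtens_index (k, l)) =
  \sum_m K m i j * (K m k l)^*.
Proof.
rewrite summxE; apply: eq_bigr => m _.
by rewrite mxE big_ord1 adjE !mxE !mxtens_indexK.
Qed.

Lemma adj_choi K : adj (choi K) = choi K.
Proof. by rewrite adj_sum; apply: eq_bigr => i _; rewrite adjM adjK. Qed.

Lemma choi_psd K (v : 'cV[C]_(n * n)) : 0 <= (adj v *m choi K *m v) 0 0.
Proof.
rewrite mulmx_sumr mulmx_suml summxE; apply: sumr_ge0 => i _.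
rewrite !mulmxA -mulmxA -{2}[v]adjK -adjM.
by rewrite mxE big_ord1 adjE -normCK exprn_ge0.
Qed.

End Choi.

Section KrausCouplings.
Variables (C : numClosedFieldType) (n : nat).

(** This is the canonical purification, which turns out to be an optimal coupling of the state with
    itself. *)
Lemma self_kraus_coupling (s : 'M[C]_n) : adj s = s ->
  kraus_coupling (fun _ : unit => s *m s) (s *m s *m (s *m s)) (s *m s *m (s *m s)).
Proof. by move=> hs; split; rewrite big_const card_unit /= addr0 adjM hs. Qed.

(** The family encodes the product state and serves to show that couplings exist. *)
Lemma product_kraus_coupling (s t : 'M[C]_n) : adj s = s -> adj t = t ->
  \tr (s *m s) = 1 -> \tr (t *m t) = 1 ->
  kraus_coupling (fun p : 'I_n * 'I_n => s *m delta_mx p.1 p.2 *m t)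
    (t *m t) (s *m s).
Proof.
have key (i k j l : 'I_n) (r : 'M[C]_n) :
    delta_mx i k *m r *m delta_mx l j = r k l *: delta_mx i j.
  apply/matrixP => x y; rewrite !mxE (bigD1 l) //= big1 ?addr0 => [|q ql].
    rewrite !mxE (bigD1 k) //= big1 ?addr0 => [|q qk].
      rewrite !mxE !eqxx /= andbT; case: (x == i); case: (y == j);
      by rewrite ?(mul1r, mul0r, mulr1, mulr0).
    by rewrite !mxE (negPf qk) andbF mul0r.
  by rewrite !mxE (negPf ql) mulr0.
have adjd i j : adj (delta_mx i j : 'M[C]_n) = delta_mx j i.
  by rewrite /adj trmx_delta map_delta_mx.
have sum_delta : \sum_i delta_mx i i = 1%:M :> 'M[C]_n.
  apply/matrixP => x y; rewrite summxE mxE (bigD1 x) //= big1 ?addr0 => [|q qx].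
    by rewrite mxE eqxx /= eq_sym.
  by rewrite mxE eq_sym (negPf qx).
move=> hs ht s1 t1; split.
  transitivity (s *m (\sum_i \sum_j (t *m t) j j *: delta_mx i i) *m s).
    rewrite pair_bigA mulmx_sumr mulmx_suml; apply: eq_bigr => -[i j] _ /=.
    by rewrite !adjM hs ht adjd -key !mulmxA.
  under eq_bigr => i _ do rewrite -scaler_suml -[\sum_j _]/(\tr (t *m t)) t1 scale1r.
  by rewrite sum_delta mulmx1.
transitivity (t *m (\sum_j \sum_i (s *m s) i i *: delta_mx j j) *m t).
  rewrite exchange_big pair_bigA mulmx_sumr mulmx_suml; apply: eq_bigr => -[i j] _ /=.
  by rewrite !adjM hs ht adjd -key !mulmxA.
under eq_bigr => i _ do rewrite -scaler_suml -[\sum_j _]/(\tr (s *m s)) s1 scale1r.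
by rewrite sum_delta mulmx1.
Qed.

End KrausCouplings.

(** * The operator $a \otimes 1 - 1 \otimes a^T$ and its cubic equation on $\mathbb{C}^2$ *)

Section TensorCommutator.
Variable C : numClosedFieldType.

Lemma tensDl m n (a b : 'M[C]_m) (c : 'M[C]_n) : (a + b) *t c = a *t c + b *t c.
Proof. by apply/matrixP => i j; rewrite !mxE mulrDl. Qed.

Lemma tensZl m n k (a : 'M[C]_m) (c : 'M[C]_n) : (k *: a) *t c = k *: (a *t c).
Proof. by apply/matrixP => i j; rewrite !mxE mulrA. Qed.

Lemma tensDr m n (c : 'M[C]_m) (a b : 'M[C]_n) : c *t (a + b) = c *t a + c *t b.
Proof. by apply/matrixP => i j; rewrite !mxE mulrDr. Qed.

Lemma tensZr m n k (c : 'M[C]_m) (a : 'M[C]_n) : c *t (k *: a) = k *: (c *t a).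
Proof. by apply/matrixP => i j; rewrite !mxE mulrCA. Qed.

Lemma tens11 m n : (1%:M : 'M[C]_m) *t (1%:M : 'M[C]_n) = 1%:M.
Proof.
apply/matrixP => i j; case: (mxtens_indexP i) => a b; case: (mxtens_indexP j) => c d.
rewrite tensmxE !mxE -natrM mulnb; congr (nat_of_bool _)%:R.
apply/idP/idP => [/andP[/eqP -> /eqP ->]//|/eqP h].
by move: (can_inj (@mxtens_indexK m n) h) => [-> ->]; rewrite !eqxx.
Qed.

(** On [cvec V] this operator acts as the commutator of [a] and [V]. *)
Definition comm_tens n (a : 'M[C]_n) : 'M[C]_(n * n) := a *t 1%:M - 1%:M *t a^T.

Lemma adj_comm_tens n (a : 'M[C]_n) : adj a = a -> adj (comm_tens a) = comm_tens a.
Proof.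
move=> ha; rewrite /comm_tens adjB; congr (_ - _); rewrite /adj trmx_tens map_mxT.
  by rewrite trmx1 map_mx1 -/(adj a) ha.
by rewrite trmx1 map_mx1 -map_trmx -/(adj a) ha.
Qed.

(** The transposed identity is kept so that every term has the shape that [choi_tens] evaluates. *)
Lemma comm_tens_sqr n (a : 'M[C]_n) : comm_tens a *m comm_tens a =
  (a *m a) *t (1%:M)^T - a *t a^T - a *t a^T + 1%:M *t (a *m a)^T.
Proof.
rewrite /comm_tens mulmxBl !mulmxBr !tensmx_mul !mul1mx !mulmx1 trmx1 trmx_mul.
by rewrite opprB addrA addrAC.
Qed.

Lemma choi_comm_tens n (I : finType) (V : I -> 'M[C]_n) rho omega a :
  kraus_coupling V rho omega ->
  \tr (choi V *m (comm_tens a *m comm_tens a)) =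
  \tr (omega *m (a *m a)) + \tr (rho *m (a *m a)) - 2 * \tr (kraus V a *m a).
Proof.
move=> [V1 V2].
rewrite comm_tens_sqr mulmxDr !mulmxBr mxtraceD !raddfB /= !choi_tens.
have -> : \tr (kraus V (a *m a) *m 1%:M) = \tr (omega *m (a *m a)).
  rewrite -V1 mulmx1 mulmx_suml !raddf_sum /=; apply: eq_bigr => i _.
  by rewrite -mulmxA mxtrace_mulC -!mulmxA mxtrace_mulC -!mulmxA mxtrace_mulC -!mulmxA.
have -> : \tr (kraus V 1%:M *m (a *m a)) = \tr (rho *m (a *m a)).
  rewrite -V2 /kraus; congr (\tr (_ *m _)); apply: eq_bigr => i _.
  by rewrite mulmx1.
by ring.
Qed.

(* Squared difference of the two eigenvalues of [a]. *)
Definition gap (a : 'M[C]_2) : C :=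
  \tr a ^+ 2 - 4 * (a 0 0 * a 1 1 - a 0 1 * a 1 0).

Lemma Cayley_Hamilton2 (a : 'M[C]_2) :
  a *m a = \tr a *: a - (a 0 0 * a 1 1 - a 0 1 * a 1 0)%:M.
Proof.
apply/matrixP => i j; rewrite !mxE /mxtrace !big_ord_recl !big_ord0 !addr0.
have -> : lift ord0 ord0 = 1 :> 'I_2 by exact/val_inj.
case: (unliftP ord0 i) => [i'|] ->; case: (unliftP ord0 j) => [j'|] ->;
  rewrite ?ord1 ?eqxx /=; 
  try (have -> : lift ord0 0 = 1 :> 'I_2 by exact/val_inj); rewrite ?mulr1n ?mulr0n; ring.
Qed.

(** The eigenvalues of [comm_tens a] are differences of eigenvalues of [a], so in dimension two only
    zero and the square roots of [gap a] occur. No diagonalisation is used: the commuting factors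
    [L] and [K] satisfy the same quadratic equation. *)
Lemma comm_tens_cubic (a : 'M[C]_2) : comm_tens a *m comm_tens a *m comm_tens a =
  gap a *: comm_tens a.
Proof.
have CH := Cayley_Hamilton2 a; set d := (a 0 0 * _ - _) in CH.
rewrite /gap -/d; set t := \tr a in CH *.
pose L : 'M[C]_(2 * 2) := a *t 1%:M; pose K : 'M[C]_(2 * 2) := 1%:M *t a^T.
have CHT : a^T *m a^T = t *: a^T - d%:M.
  by rewrite -trmx_mul CH linearB linearZ /= tr_scalar_mx.
have LL : L *m L = t *: L - d%:M.
  rewrite tensmx_mul mulmx1 CH -scaleN1r -[d%:M]scalemx1 tensDl !tensZl tens11.
  by rewrite scaleN1r scalemx1.
have KK : K *m K = t *: K - d%:M.
  rewrite tensmx_mul mulmx1 CHT -scaleN1r -[d%:M]scalemx1 tensDr !tensZr tens11.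
  by rewrite scaleN1r scalemx1.
have LK : L *m K = K *m L by rewrite !tensmx_mul !mul1mx !mulmx1.
rewrite -[comm_tens a]/(L - K).
clearbody L K d t.
have LKL : L *m K *m L = t *: (L *m K) - d *: K.
  by rewrite LK -mulmxA LL mulmxBr -scalemxAr mul_mx_scalar.
have LKK : L *m K *m K = t *: (L *m K) - d *: L.
  by rewrite -mulmxA KK mulmxBr -scalemxAr mul_mx_scalar.
have -> : (L - K) *m (L - K) = t *: (L + K) - (2 * d)%:M - 2 *: (L *m K).
  rewrite mulmxBl !mulmxBr -LK LL KK -[d%:M]scalemx1 -[(2 * d)%:M]scalemx1.
  by move: (L *m K) => N; apply/matrixP => i j; rewrite !mxE; ring.
rewrite !mulmxBl -!scalemxAl mulmxDl mul_scalar_mx !mulmxBr LL KK -LK LKL LKK.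
by move: (L *m K) => N; apply/matrixP => i j; rewrite !mxE; ring.
Qed.

End TensorCommutator.

(** * Couplings of states as Kraus families *)

Section States.
Variables (R : realType) (n : nat).
Local Notation C := R[i].
Implicit Types (rho omega : 'M[C]_n) (P : 'M[C]_(n * n)).

Lemma selfadjP m (M : 'M[C]_m) : selfadj M <-> adj M = M.
Proof. by rewrite /selfadj hermsymE; split=> [/eqP|/eqP]. Qed.

Lemma posmx_fourth_root m (M : 'M[C]_m) : posmx M ->
  exists s, exists s', herm_pinv s s' /\ s *m s *m (s *m s) = M.
Proof.
move=> [/selfadjP hM pM]; apply: (psd_fourth_root hM) => v.
by rewrite /adj -map_trmx; exact: pM.
Qed.

Lemma ptrace2_choi (I : finType) (V : I -> 'M[C]_n) :
  ptrace2 (choi V) = \sum_i V i *m adj (V i).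
Proof.
apply/matrixP => i k; rewrite !mxE summxE.
under eq_bigr => j _ do rewrite choiE.
rewrite exchange_big; apply: eq_bigr => m _; rewrite mxE.
by apply: eq_bigr => j _; rewrite adjE.
Qed.

Lemma ptrace1_choi (I : finType) (V : I -> 'M[C]_n) :
  ptrace1 (choi V) = (\sum_i adj (V i) *m V i)^T.
Proof.
apply/matrixP => j l; rewrite !mxE summxE.
under eq_bigr => i _ do rewrite choiE.
rewrite exchange_big; apply: eq_bigr => m _; rewrite mxE.
by apply: eq_bigr => i _; rewrite adjE mulrC.
Qed.

Lemma choi_coupling (I : finType) (V : I -> 'M[C]_n) rho omega :
  is_state omega -> kraus_coupling V rho omega -> couplings rho omega (choi V).
Proof.
move=> [_ t1] [V1 V2]; split; last by rewrite ptrace2_choi ptrace1_choi V1 V2.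
split; first split.
- by apply/selfadjP/adj_choi.
- by move=> v; rewrite map_trmx; apply: choi_psd.
rewrite raddf_sum -t1 -V1 raddf_sum /=; apply: eq_bigr => i _.
by rewrite mxtrace_mulC cvec_dot mxtrace_scalar mulr1n mxtrace_mulC.
Qed.

(** The columns of the square root of [P], reshaped into matrices, are the Kraus operators. *)
Lemma coupling_choi rho omega P : couplings rho omega P ->
  exists2 V : 'I_(n * n) -> 'M[C]_n, kraus_coupling V rho omega & P = choi V.
Proof.
move=> [[pP _] [P2 P1]]; have [s [s' [[s1 _ _ _ _] sP]]] := posmx_fourth_root pP.
pose V m : 'M[C]_n := \matrix_(i, j) (s *m s) (mxtens_index (i, j)) m.
have PV : P = choi V.
  rewrite -sP; apply/matrixP => p q.
  case: (mxtens_indexP p) => i j; case: (mxtens_indexP q) => k l.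
  have ss : adj (s *m s) = s *m s by rewrite adjM s1.
  rewrite choiE mxE; apply: eq_bigr => m _; rewrite [V m i j]mxE [V m k l]mxE.
  by rewrite -[in RHS]adjE ss.
exists V => //; split.
  by rewrite -ptrace2_choi -PV.
by apply: (can_inj (@trmxK _ _ _)); rewrite -ptrace1_choi -PV.
Qed.

End States.

(** * Absolute powers of a Hermitian operator with a cubic equation *)

Section Cost.

(** Stated for the very diagonalisation inside [abspow], so that powers can be compared entry by
    entry. *)
Lemma herm_cubic_spectral (C : numClosedFieldType) n (X : 'M[C]_n) (d : C) :
  adj X = X -> X *m X *m X = d *: X ->
  let U := spectralmx X in let D := spectral_diag X in
  [/\ X *m X = invmx U *m diag_mx (\row_i (D 0 i * D 0 i)) *m U,
      forall i, D 0 i \is Num.real & forall i, D 0 i * D 0 i * D 0 i = d * D 0 i].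
Proof.
move=> hX X3 U D.
have Uu : U \in unitmx by exact: spectral_unit.
have hs : X \is hermsymmx by rewrite hermsymE hX.
have eX : X = invmx U *m diag_mx D *m U.
  exact/orthomx_spectralP/hermitian_normalmx.
have Dr i : D 0 i \is Num.real by exact: (mxOverP (hermitian_spectral_diag_real hs)).
clearbody U D.
have MM (E F : 'rV[C]_n) : (invmx U *m diag_mx E *m U) *m (invmx U *m diag_mx F *m U) =
    invmx U *m diag_mx (\row_i (E 0 i * F 0 i)) *m U.
  by rewrite -!mulmxA mulKVmx // [diag_mx E *m (_ *m U)]mulmxA mulmx_diag.
have XX : X *m X = invmx U *m diag_mx (\row_i (D 0 i * D 0 i)) *m U.
  by rewrite -MM -eX.
have XXX : X *m X *m X = invmx U *m diag_mx (\row_i (D 0 i * D 0 i * D 0 i)) *m U.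
  rewrite XX {1}eX MM.
  by congr (_ *m diag_mx _ *m _); apply/rowP => i; rewrite !mxE.
have D3 i : D 0 i * D 0 i * D 0 i = d * D 0 i.
  move: X3; rewrite XXX {1}eX => /(congr1 (fun M => U *m M *m invmx U)).
  rewrite -scalemxAr -scalemxAl !mulmxA !mulmxV // !mul1mx -!mulmxA !mulmxV // !mulmx1.
  by move/matrixP/(_ i i); rewrite !mxE eqxx !mulr1n.
by split.
Qed.

(** A nonzero eigenvalue [k] satisfies [k^2 = d], so [|k|^p = |k|^(p-2) k^2] has the same first
    factor for all of them. *)
Lemma abspow_cubic (R : realType) n (X : 'M[R[i]]_n) (d : R[i]) (p : R) : p != 0 ->
  adj X = X -> X *m X *m X = d *: X ->
  abspow p X = ((powR (Num.sqrt (Normc.normc d)) (p - 2))%:C)%C *: (X *m X).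
Proof.
move=> p0 hX X3; have [XX Dr D3] := herm_cubic_spectral hX X3.
rewrite XX /abspow scalemxAl scalemxAr; congr (_ *m _ *m _).
move: (spectral_diag X) Dr D3 => D Dr D3.
apply/matrixP => i j; rewrite !mxE; case: (i == j); last by rewrite !mulr0n mulr0.
rewrite !mulr1n.
have [k kE] : exists k, D 0 i = (k%:C)%C by exact/complex_realP/Dr.
have nk : Normc.normc (D 0 i) = `|k|.
  by rewrite kE /= expr0n /= addr0 sqrtr_sqr.
(* For a zero eigenvalue both sides vanish, [p != 0] ruling out the value [powR 0 0 = 1]. *)
have := D3 i; rewrite nk kE; have [-> _|k0] := eqVneq k 0.
  by rewrite normr0 powR0 // mulr0 mulr0.
have kC : (k%:C)%C != 0 by rewrite -[0]/((0 : R)%:C)%C (inj_eq (@complexI _)).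
move=> /(mulIf kC) <-.
rewrite Normc.normcM -kE nk -expr2 sqrtr_sqr normr_id -expr2 kE -rmorphXn -rmorphM.
congr (_%:C)%C; rewrite -real_normK ?num_real //.
rewrite -powR_mulrn // -powRD ?subrK //.
by rewrite normr_eq0 k0 implybT.
Qed.

End Cost.

(** * The divergence as an infimum *)

Section RealLemmas.
Variable R : realType.

(** For [z] between 0 and 1, [z <= z^e]; this is applied to [x / (x + y)] and [y / (x + y)]. *)
Lemma powR_subadditive (x y e : R) : 0 <= x -> 0 <= y -> 0 < e -> e <= 1 ->
  powR (x + y) e <= powR x e + powR y e.
Proof.
move=> x0 y0 e0 e1; have [->|xy0] := eqVneq (x + y) 0.
  by rewrite powR0 ?gt_eqF // addr_ge0 ?powR_ge0.
have xy : 0 < x + y by rewrite lt_neqAle eq_sym xy0 addr_ge0.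
have key z : 0 <= z -> z <= x + y -> z / (x + y) * powR (x + y) e <= powR z e.
  move=> z0 zxy; rewrite -[in leRHS](divfK xy0 z) powRM ?divr_ge0 ?(ltW xy) //.
  rewrite ler_wpM2r ?powR_ge0 //; have [->|z_neq0] := eqVneq z 0.
    by rewrite mul0r powR_ge0.
  have zp : 0 < z by rewrite lt_neqAle eq_sym z_neq0.
  by rewrite ger1_powR // divr_gt0 //= ler_pdivrMr // mul1r.
have := lerD (key x x0 _) (key y y0 _).
rewrite -mulrDl -mulrDl divff // mul1r; apply; first by rewrite lerDl.
by rewrite lerDr.
Qed.

(** The slack [e] allows for nearly optimal couplings and keeps both roots positive, so that the
    optimal [l] exists. *)
Lemma sqrt_triangle (q x y : R) : 0 <= x -> 0 <= y ->
  (forall l e, 0 < l -> 0 < e -> q <= (1 + l) * (x + e) + (1 + l^-1) * (y + e)) ->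
  Num.sqrt q <= Num.sqrt x + Num.sqrt y.
Proof.
move=> x0 y0 h; apply/ler_addgt0Pr => d d0.
(* Chosen so that adding [e] under a root costs at most [d / 2]. *)
pose e := (d / 2) ^+ 2; have d20 : 0 < d / 2 by rewrite divr_gt0.
have e0 : 0 < e by rewrite exprn_gt0.
have sqrtD z : 0 <= z -> Num.sqrt (z + e) <= Num.sqrt z + d / 2.
  move=> z0; rewrite -[leRHS]ger0_norm ?addr_ge0 ?sqrtr_ge0 ?(ltW d20) // -sqrtr_sqr.
  rewrite ler_wsqrtr // sqrrD sqr_sqrtr // addrAC lerDl.
  by rewrite mulrn_wge0 // mulr_ge0 ?sqrtr_ge0 // (ltW d20).
set u := Num.sqrt (x + e); set v := Num.sqrt (y + e).
have u0 : 0 < u by rewrite sqrtr_gt0 ltr_wpDl.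
have v0 : 0 < v by rewrite sqrtr_gt0 ltr_wpDl.
have uE : x + e = u ^+ 2 by rewrite sqr_sqrtr // addr_ge0 // (ltW e0).
have vE : y + e = v ^+ 2 by rewrite sqr_sqrtr // addr_ge0 // (ltW e0).
have quv : q <= (u + v) ^+ 2.
  (* At the minimiser [l = v / u] the right-hand side is exactly [(u + v) ^+ 2]. *)
  apply: le_trans (h (v / u) e _ e0) _; first by rewrite divr_gt0.
  rewrite uE vE le_eqVlt; apply/orP; left; apply/eqP.
  by field; rewrite !gt_eqF.
have : Num.sqrt q <= u + v.
  by rewrite -[leRHS]ger0_norm ?addr_ge0 ?(ltW u0) ?(ltW v0) // -sqrtr_sqr ler_wsqrtr.
move/le_trans; apply; have := lerD (sqrtD x x0) (sqrtD y y0).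
by rewrite -/u -/v addrACA -splitr.
Qed.

End RealLemmas.

Section Divergence.
Variables (R : realType) (A : seq 'M[R[i]]_2) (p : R).
Hypothesis hA : forall a, a \in A -> selfadj a.
Hypothesis hp : 2 <= p.
Local Notation C := R[i].
Implicit Types (s t : 'M[C]_2).

Let p_gt0 : 0 < p. Proof. by rewrite (lt_le_trans _ hp). Qed.

(** For Hermitian [a] the base is the distance between its two eigenvalues; the power is the scalar
    relating $|X|^p$ to $X^2$. *)
Definition weight (a : 'M[C]_2) : R := powR (Num.sqrt (Normc.normc (gap a))) (p - 2).

(* Weighted Wigner-Yanase skew information of the state [s ^ 4]. *)
Definition skew_info s : R := \sum_(a <- A) weight a *
  complex.Re (\tr (s *m s *m (s *m s) *m (a *m a)) - kms (s *m s) a a).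

(** The coupling-dependent part of the cost, shifted so as to be nonnegative on couplings and zero
    on the canonical self-coupling. *)
Definition excess (I : finType) (V : I -> 'M[C]_2) s t : R := \sum_(a <- A) weight a *
  complex.Re (kms (s *m s) a a + kms (t *m t) a a - 2 * \tr (kraus V a *m a)).

Lemma weight_ge0 a : 0 <= weight a. Proof. exact: powR_ge0. Qed.

Lemma ReD (x y : C) : complex.Re (x + y) = complex.Re x + complex.Re y.
Proof. by case: x; case: y. Qed.

Lemma ReZ (k : R) (z : C) : complex.Re ((k%:C)%C * z) = k * complex.Re z.
Proof. by case: z => x y /=; rewrite mul0r subr0. Qed.

Lemma Re_sum (I : Type) (r : seq I) (F : I -> C) :
  complex.Re (\sum_(i <- r) F i) = \sum_(i <- r) complex.Re (F i).
Proof. exact: (big_morph _ ReD). Qed.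

Lemma Re_ge0 (z : C) : 0 <= z -> 0 <= complex.Re z.
Proof. by rewrite lecE => /andP[]. Qed.

Lemma adjA a : a \in A -> adj a = a.
Proof. by move=> /hA/selfadjP. Qed.

Lemma skew_info_ge0 s : adj s = s -> 0 <= skew_info s.
Proof.
move=> hs; rewrite /skew_info big_seq; apply: sumr_ge0 => a /adjA ha.
rewrite mulr_ge0 ?weight_ge0 //; apply: Re_ge0.
by rewrite subr_ge0; exact: kms_le.
Qed.

(** Adding and subtracting the KMS norms in the quadratic cost separates what depends on the
    marginals from what depends on [V]. *)
Lemma transport_costE (I : finType) (V : I -> 'M[C]_2) s t :
  kraus_coupling V (s *m s *m (s *m s)) (t *m t *m (t *m t)) ->
  transport_cost A p (choi V) = skew_info s + skew_info t + excess V s t.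
Proof.
move=> hV.
rewrite /transport_cost /cost mulmx_sumr (raddf_sum (@mxtrace C _)) Re_sum.
rewrite /skew_info /excess -!big_split /=.
rewrite big_seq [RHS]big_seq; apply: eq_bigr => a /adjA ha.
rewrite -/(comm_tens a).
rewrite (abspow_cubic (lt0r_neq0 p_gt0) (adj_comm_tens ha) (comm_tens_cubic a)).
rewrite -/(weight a) -scalemxAr mxtraceZ (choi_comm_tens a hV) ReZ -!mulrDr -!ReD.
congr (_ * complex.Re _); move: (\tr _) (\tr _) (\tr _) (kms _ _ _) (kms _ _ _).
by move=> x y z v w; ring.
Qed.

End Divergence.

(** * Optimal costs and the triangle inequality *)

Section Triangle.
Local Open Scope classical_set_scope.
Variables (R : realType) (A : seq 'M[R[i]]_2) (p : R).
Hypothesis hA : forall a, a \in A -> selfadj a.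
Hypothesis hp : 2 <= p.
Local Notation C := R[i].
Implicit Types (s t u : 'M[C]_2).

Let p_gt0 : 0 < p. Proof. by rewrite (lt_le_trans _ hp). Qed.

Definition pow4 s := s *m s *m (s *m s).

Lemma excess_ge0 (I : finType) (V : I -> 'M[C]_2) s s' t t' :
  herm_pinv s s' -> herm_pinv t t' -> kraus_coupling V (pow4 s) (pow4 t) ->
  0 <= excess A p V s t.
Proof.
move=> hs ht [V1 V2]; rewrite /excess big_seq; apply: sumr_ge0 => a aA.
have ha := adjA hA aA; rewrite mulr_ge0 ?weight_ge0 //; apply: Re_ge0.
rewrite subr_ge0 [leRHS]addrC.
exact: (kraus_bound ht hs V1 V2 ha ha).
Qed.

Lemma excess_self s : adj s = s -> excess A p (fun _ : unit => s *m s) s s = 0.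
Proof.
move=> hs; rewrite /excess big1 // => a _.
rewrite /kraus big_const card_unit /= addr0 adjM hs /kms.
by rewrite mulr_natl mulr2n subrr mulr0.
Qed.

Definition opt_cost rho omega : R :=
  inf [set transport_cost A p P | P in couplings rho omega].

Lemma opt_cost_le (I : finType) (V : I -> 'M[C]_2) s s' t t' :
  herm_pinv s s' -> herm_pinv t t' -> is_state (pow4 t) ->
  kraus_coupling V (pow4 s) (pow4 t) ->
  opt_cost (pow4 s) (pow4 t) <=
  skew_info A p s + skew_info A p t + excess A p V s t.
Proof.
move=> hs ht st hV; apply: ge_inf; last first.
  by exists (choi V); [apply: choi_coupling|apply: transport_costE].
(* A lower bound is required, since [inf] has a default value on sets unbounded below. *)
exists (skew_info A p s + skew_info A p t) => _ [P /coupling_choi [W hW ->] <-].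
by rewrite (transport_costE hA hp hW) lerDl; apply: excess_ge0 hs ht hW.
Qed.

(** Nonemptiness keeps the infimum away from its default value. *)
Lemma couplings_neq0 s s' t t' :
  herm_pinv s s' -> herm_pinv t t' -> is_state (pow4 s) -> is_state (pow4 t) ->
  exists P, couplings (pow4 s) (pow4 t) P.
Proof.
move=> [hs _ _ _ _] [ht _ _ _ _] [_ s1] st.
have e (r : 'M[C]_2) : adj r = r -> adj (r *m r) = r *m r by move=> h; rewrite adjM h.
exists (choi (fun q : 'I_2 * 'I_2 => (t *m t) *m delta_mx q.1 q.2 *m (s *m s))).
apply: (choi_coupling st).
exact: (product_kraus_coupling (e _ ht) (e _ hs) st.2 s1).
Qed.

Lemma opt_cost_adherent s s' t t' e :
  herm_pinv s s' -> herm_pinv t t' -> is_state (pow4 s) -> is_state (pow4 t) ->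
  0 < e -> exists2 V : 'I_(2 * 2) -> 'M[C]_2, kraus_coupling V (pow4 s) (pow4 t) &
  skew_info A p s + skew_info A p t + excess A p V s t < opt_cost (pow4 s) (pow4 t) + e.
Proof.
move=> hs ht ss st e0.
have hinf : has_inf [set transport_cost A p P | P in couplings (pow4 s) (pow4 t)].
  split.
    have [P hP] := couplings_neq0 hs ht ss st.
    by exists (transport_cost A p P), P.
  exists (skew_info A p s + skew_info A p t) => _ [P /coupling_choi [W hW ->] <-].
  by rewrite (transport_costE hA hp hW) lerDl; apply: excess_ge0 hs ht hW.
have [_ [P /coupling_choi [V hV ->] <-] h] := inf_adherent e0 hinf.
by exists V => //; rewrite -(transport_costE hA hp hV).
Qed.

Lemma opt_cost_ge s s' t t' :
  herm_pinv s s' -> herm_pinv t t' -> is_state (pow4 s) -> is_state (pow4 t) ->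
  skew_info A p s + skew_info A p t <= opt_cost (pow4 s) (pow4 t).
Proof.
move=> hs ht ss st; apply: lb_le_inf.
  have [P hP] := couplings_neq0 hs ht ss st.
  by exists (transport_cost A p P), P.
move=> _ [P /coupling_choi [W hW ->] <-].
by rewrite (transport_costE hA hp hW) lerDl; apply: excess_ge0 hs ht hW.
Qed.

(** The general lower bound is attained by the canonical self-coupling, whose excess is zero. *)
Lemma opt_cost_self s s' : herm_pinv s s' -> is_state (pow4 s) ->
  opt_cost (pow4 s) (pow4 s) = skew_info A p s + skew_info A p s.
Proof.
move=> hs ss; have [h1 _ _ _ _] := hs.
apply/le_anti; rewrite (opt_cost_ge hs hs) // andbT.
apply: le_trans (opt_cost_le hs hs ss (self_kraus_coupling h1)) _.
by rewrite excess_self // addr0.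
Qed.

(** On states this is the [p]-th power of the divergence; as the infimum of a quadratic excess it
    behaves like a squared distance. *)
Definition sqdiv rho omega : R :=
  opt_cost rho omega - 2^-1 * (opt_cost rho rho + opt_cost omega omega).

Lemma sqdivE s s' t t' :
  herm_pinv s s' -> herm_pinv t t' -> is_state (pow4 s) -> is_state (pow4 t) ->
  sqdiv (pow4 s) (pow4 t) =
  opt_cost (pow4 s) (pow4 t) - (skew_info A p s + skew_info A p t).
Proof.
move=> hs ht ss st; rewrite /sqdiv (opt_cost_self hs ss) (opt_cost_self ht st).
by move: (opt_cost _ _) (skew_info _ _ s) (skew_info _ _ t) => c x y; field.
Qed.

Lemma sqdiv_ge0 s s' t t' :
  herm_pinv s s' -> herm_pinv t t' -> is_state (pow4 s) -> is_state (pow4 t) ->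
  0 <= sqdiv (pow4 s) (pow4 t).
Proof.
move=> hs ht ss st; rewrite (sqdivE hs ht) // subr_ge0.
exact: (opt_cost_ge hs ht).
Qed.

Lemma excess_glue (I J : finType) (V : I -> 'M[C]_2) (U : J -> 'M[C]_2)
    s s' t t' u u' (l : R) :
  herm_pinv s s' -> herm_pinv t t' -> herm_pinv u u' ->
  kraus_coupling V (pow4 s) (pow4 t) -> kraus_coupling U (pow4 t) (pow4 u) -> 0 < l ->
  excess A p (glue V U t') s u <=
  (1 + l) * excess A p V s t + (1 + l^-1) * excess A p U t u.
Proof.
move=> hs ht hu hV hU l0; rewrite /excess !mulr_sumr -big_split /=.
rewrite big_seq [leRHS]big_seq; apply: ler_sum => a aA.
rewrite ![(1 + _) * _]mulrCA -mulrDr ler_wpM2l ?weight_ge0 //.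
have lC : 0 < (l%:C)%C by rewrite ltcR.
have := glue_bound hs ht hu hV hU (adjA hA aA) lC.
have e1 (k : R) : 1 + (k%:C)%C = ((1 + k)%:C)%C by rewrite rmorphD rmorph1.
move: (kms _ _ _) (kms _ _ _) (kms _ _ _) (\tr _) (\tr _) (\tr _) => x y z x' y' z'.
(* The complex order gives the inequality of real parts, and the coefficients are real. *)
by rewrite -fmorphV !e1 lecE => /andP[_]; rewrite [complex.Re (_ * _ + _)]ReD !ReZ.
Qed.

(** Couplings within [e] of the optimum are glued, and the excess of the composite bounds the left
    side for every [l]. *)
Lemma sqdiv_triangle s s' t t' u u' :
  herm_pinv s s' -> herm_pinv t t' -> herm_pinv u u' ->
  is_state (pow4 s) -> is_state (pow4 t) -> is_state (pow4 u) ->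
  Num.sqrt (sqdiv (pow4 s) (pow4 u)) <=
  Num.sqrt (sqdiv (pow4 s) (pow4 t)) + Num.sqrt (sqdiv (pow4 t) (pow4 u)).
Proof.
move=> hs ht hu ss st su.
apply: sqrt_triangle; [exact: sqdiv_ge0 hs ht ss st|exact: sqdiv_ge0 ht hu st su|].
move=> l e l0 e0.
have [V hV Ve] := opt_cost_adherent hs ht ss st e0.
have [U hU Ue] := opt_cost_adherent ht hu st su e0.
have hZ := glue_coupling ht hV hU.
have hle := opt_cost_le hs hu su hZ.
have hgl := excess_glue hs ht hu hV hU l0.
rewrite (sqdivE hs hu ss su) (sqdivE hs ht ss st) (sqdivE ht hu st su).
have h1 : opt_cost (pow4 s) (pow4 u) - (skew_info A p s + skew_info A p u) <=
  excess A p (glue V U t') s u by rewrite lerBlDl.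
have slack (x y z d : R) : x + y < z + d -> y <= z - x + d.
  by move=> /ltW; rewrite -lerBrDl addrAC.
apply: le_trans h1 (le_trans hgl _).
apply: lerD; apply: ler_wpM2l; rewrite ?addr_ge0 ?invr_ge0 ?(ltW l0) //.
  exact: slack Ve.
exact: slack Ue.
Qed.

Lemma wdist_powR rho omega : 0 <= opt_cost rho omega ->
  powR (wdist A p rho omega) (Num.max p 1) = opt_cost rho omega.
Proof.
move=> c0; have p1 : 1 <= p by rewrite (le_trans _ hp) // ler1n.
rewrite /wdist -/(opt_cost rho omega) max_l // min_l ?invf_le1 //.
by rewrite -powRrM mulVf ?gt_eqF // powRr1.
Qed.

(** The exponent [1 / p] is split as one half times [2 / p], to reach the square root to which the
    triangle inequality applies. *)
Lemma wdivE rho omega : 0 <= opt_cost rho omega -> 0 <= opt_cost rho rho ->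
  0 <= opt_cost omega omega -> 0 <= sqdiv rho omega ->
  wdiv A p rho omega = powR (Num.sqrt (sqdiv rho omega)) (2 / p).
Proof.
move=> c1 c2 c3 d0; have p1 : 1 <= p by rewrite (le_trans _ hp) // ler1n.
rewrite /wdiv !wdist_powR // -/(sqdiv rho omega) min_l ?invf_le1 //.
by rewrite -powR12_sqrt // -powRrM mulrA mulVf // mul1r.
Qed.

Lemma wdiv_sqdiv s s' t t' :
  herm_pinv s s' -> herm_pinv t t' -> is_state (pow4 s) -> is_state (pow4 t) ->
  wdiv A p (pow4 s) (pow4 t) = powR (Num.sqrt (sqdiv (pow4 s) (pow4 t))) (2 / p).
Proof.
have ge0 r r' q q' : herm_pinv r r' -> herm_pinv q q' ->
    is_state (pow4 r) -> is_state (pow4 q) -> 0 <= opt_cost (pow4 r) (pow4 q).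
  move=> hr hq sr sq; apply: le_trans (opt_cost_ge hr hq sr sq).
  by case: hr => ? _ _ _ _; case: hq => ? _ _ _ _; rewrite addr_ge0 ?skew_info_ge0.
move=> hs ht ss st; apply: wdivE; last exact: sqdiv_ge0 hs ht ss st.
- exact: (ge0 _ _ _ _ hs ht).
- exact: (ge0 _ _ _ _ hs hs).
- exact: (ge0 _ _ _ _ ht ht).
Qed.

End Triangle.

Theorem theorem6p2 (R : realType) (A : seq 'M[R[i]]_2) (p : R)
  (hA : forall a, a \in A -> selfadj a) (hp : 2 <= p)
  (rho tau omega : 'M[R[i]]_2) :
  is_state rho -> is_state tau -> is_state omega ->
  wdiv A p rho omega <= wdiv A p rho tau + wdiv A p tau omega.
Proof.
move=> sr st so.
have [s [s' [hs es]]] := posmx_fourth_root sr.1.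
have [t [t' [ht et]]] := posmx_fourth_root st.1.
have [u [u' [hu eu]]] := posmx_fourth_root so.1.
move: sr st so; rewrite -es -et -eu => ss st su.
have p0 : 0 < p by rewrite (lt_le_trans _ hp).
rewrite (wdiv_sqdiv hA hp hs hu ss su) (wdiv_sqdiv hA hp hs ht ss st).
rewrite (wdiv_sqdiv hA hp ht hu st su).
(* As [p] is at least 2, the exponent lies in the interval from 0 to 1, where powers are increasing
   and subadditive. *)
have e0 : 0 < 2 / p by rewrite divr_gt0.
apply: le_trans (powR_subadditive (sqrtr_ge0 _) (sqrtr_ge0 _) e0 _); last first.
  by rewrite ler_pdivrMr // mul1r.
apply: (ge0_ler_powR (ltW e0)); rewrite ?nnegrE; first exact: sqrtr_ge0.
  by apply: addr_ge0; exact: sqrtr_ge0.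
exact: (sqdiv_triangle hA hp hs ht hu ss st su).
Qed.
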